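(* If $(X,\tau,+)$ is a Hausdorff commutative monoid and $\Sigma\colon X^*\rightharpoonup X$ is its extended monoid operation, then $(X,\Sigma)$ is a finitely total $\Sigma$-monoid.
   Context: Families. Fix an infinite set $\mathcal I$. A family of elements of a set $X$ is an indexed multiset $\{x_i\}_{i\in I}$ with $x_i\in X$ and $I\subseteq\mathcal I$ countable (finite and empty allowed); two families $\{x_i\}_I,\{y_j\}_J$ are identified if there is a bijection $\phi\colon I\to J$ with $x_i=y_{\phi(i)}$ for all $i$. $X^*$ is the set of all families; bold letters denote families. The disjoint union $\uplus_J\mathbf x_j$ of families is indexed by the disjoint union of the index sets. A subfamily is the restriction of a family to a subset of its index set. For a partial function $\Sigma\colon X^*\rightharpoonup X$, ''$\Sigma\mathbf x\simeq x$'' means $\Sigma\mathbf x$ is defined and equals $x$; $\mathbf x$ is summable if $\Sigma\mathbf x$ is defined. A weak $\Sigma$-monoid is a set $X$ with a partial function $\Sigma\colon X^*\rightharpoonup X$ such that: (Singleton) $\Sigma\{x\}\simeq x$ for all $x\in X$; (Neutral element) there is $0\in X$ with $\Sigma\emptyset\simeq 0$, and if $\mathbf x$ is summable then so is its subfamily $\mathbf x_\emptyset$ of elements other than $0$; (Bracketing) if $\{\mathbf x_j\}_J$ ($J$ countable) is an indexed set of finite summable families and $\mathbf x=\uplus_J\mathbf x_j$, then $\Sigma\mathbf x\simeq x$ implies $\Sigma\{\Sigma\mathbf x_j\}_J\simeq x$; (Flattening) if $\{\mathbf x_j\}_J$ is a finite indexed set of (possibly infinite) summable families and $\mathbf x=\uplus_J\mathbf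 x_j$, then $\Sigma\{\Sigma\mathbf x_j\}_J\simeq x$ implies $\Sigma\mathbf x\simeq x$. A finitely total $\Sigma$-monoid is a weak $\Sigma$-monoid in which every finite family is summable. A Hausdorff commutative monoid $(X,\tau,+)$ is a commutative monoid $(X,+)$ with a Hausdorff topology $\tau$ on $X$ for which $+\colon X\times X\to X$ is continuous. Its extended monoid operation $\Sigma\colon X^*\rightharpoonup X$ is defined as follows: for $\mathbf x\in X^*$ let $\mathcal F(\mathbf x)$ be the directed set of finite subfamilies of $\mathbf x$ (i.e. finite subsets of its index set) ordered by inclusion, and $\sigma\colon\mathcal F(\mathbf x)\to X$ the net sending a finite subfamily to the sum of its elements under $+$; then $\Sigma\mathbf x=x$ if $\lim\sigma=x$ (the net converges to $x$), and $\Sigma\mathbf x$ is undefined if $\sigma$ has no limit. *)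

(* Defs.v *)
From HB Require Import structures.
From mathcomp Require Import all_boot all_order all_algebra finmap.
From mathcomp Require Import all_classical all_reals all_analysis.
From mathcomp.analysis Require showcase.summability.

Set Implicit Arguments.
Unset Strict Implicit.
Unset Printing Implicit Defensive.

Import GRing.Theory.
Local Open Scope classical_set_scope.
Local Open Scope ring_scope.

Section Families.
Context {I : choiceType} {X : Type}.

Record Family := MkFamily {
  idx : set I;
  idx_countable : countable idx;
  elt : idx -> X
}.

Arguments elt : clear implicits.

(* Two families are the same element of X^* when they are identified; X^* is
   handled as the setoid (Family, identified). *)
Definition identified (x y : Family) : Prop :=
  exists phi : idx x -> idx y,
    bijective phi /\ forall i, elt x i = elt y (phi i).

Definition empty_family : Family :=
  MkFamily (countable0 I)
    (fun i : (set0 : set I) => False_rect X (set_mem (valP i))).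

Definition singleton_family (i : I) (a : X) : Family :=
  MkFamily (countable1 i) (fun _ => a).

Definition finite_family (x : Family) : Prop := finite_set (idx x).

Lemma subfamily_idx (x : Family) (K : set (idx x)) : val @` K `<=` idx x.
Proof. by move=> _ [i _ <-]; exact: set_valP. Qed.

Definition subfamily (x : Family) (K : set (idx x)) : Family :=
  MkFamily (sub_countable (subset_card_le (@subfamily_idx x K)) (idx_countable x))
    (fun i : val @` K =>
       elt x (exist _ (val i) (mem_set (subfamily_idx (set_mem (valP i)))))).

(* The disjoint union of the index sets is a set of pairs, not a subset of I,
   so the disjoint union of families is only determined up to identification:
   x is a disjoint union of the xs j when it is in value-preserving bijection
   with the disjoint union of their index sets. *)
Definition is_disjoint_union (J : set I) (xs : J -> Family) (x : Family)
    : Prop :=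
  exists phi : idx x -> {j : J & idx (xs j)},
    bijective phi /\
    forall i, elt x i = elt (xs (tag (phi i))) (tagged (phi i)).

End Families.

Arguments Family : clear implicits.
Arguments elt {I X}.

(* As I is infinite, every countable indexed set of families does have a
   disjoint union indexed by a subset of I. *)
Lemma disjoint_union_exists (I : choiceType) (X : Type)
    (infI : infinite_set [set: I]) (J : set I) (cJ : countable J)
    (xs : J -> Family I X) :
  exists x : Family I X, is_disjoint_union xs x.
Proof.
have injN T (A : set T) : countable A -> {f : T -> nat | {in A &, injective f}}.
  by move=> cA; apply: cid; exact/countable_injP.
have [f fP] := injN _ _ cJ.
pose g (p : {j : J & idx (xs j)}) : nat :=
  choice.pickle (f (val (tag p)),
    sval (injN _ _ (idx_countable (xs (tag p)))) (val (tagged p))).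
have g_inj : injective g.
  move=> [j a] [k b] /(pcan_inj choice.pickleK) [] /=.
  move=> /fP; rewrite !inE => jk.
  have {}jk : j = k by apply: val_inj; apply: jk; exact: set_valP.
  move: b; rewrite -{}jk => b; case: (injN _ _ _) => h hP /= /hP.
  rewrite !inE => ab.
  by congr existT; apply: val_inj; apply: ab; exact: set_valP.
have /infiniteP/card_leP[h0] := infI.
pose h (n : nat) : I := val (h0 (exist _ n (mem_set Logic.I))).
have h_inj : injective h.
  move=> m n /val_inj /(@inj _ _ _ h0) hmn.
  by have /(congr1 val) := hmn (mem_set Logic.I) (mem_set Logic.I).
pose e := h \o g.
have e_inj : injective e by exact: inj_comp.
have ce : countable (range e).
  apply/countable_injP; exists (fun i => xget 0%N [set n | h n = i]).
  move=> _ _ /set_mem[p _ <-] /set_mem[q _ <-].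
  have E n : xget 0%N [set m | h m = h n] = n.
    by apply: h_inj; case: xgetP => [m _ //|/(_ n)/(_ erefl)].
  by rewrite /e /= !E => ->.
have pre (i : range e) : {p | e p = val i}.
  by apply: cid; case: (set_mem (valP i)) => p _ ep; exists p.
pose phi i := sval (pre i).
exists (MkFamily ce (fun i => elt _ (tagged (phi i)))), phi; split => //.
have er p : e p \in range e by apply: mem_set; exists p.
exists (fun p => exist _ (e p) (er p)) => [i|p].
  by apply: val_inj; exact: (svalP (pre i)).
by apply: e_inj; exact: (svalP (pre (exist _ (e p) (er p)))).
Qed.

Section SigmaMonoids.
Context {I : choiceType} {X : Type}.

(* [Sigma x = Some a] reads "Sigma x is defined and equals a". *)
Implicit Type Sigma : Family I X -> option X.

Definition is_summable Sigma (x : Family I X) : Prop :=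
  exists a, Sigma x = Some a.

Record weak_Sigma_monoid Sigma : Prop := {
  (* Sigma is a well-defined partial function on X^* *)
  Sigma_identified : forall x y, identified x y -> Sigma x = Sigma y;
  Sigma_singleton : forall (i : I) (a : X),
    Sigma (singleton_family i a) = Some a;
  Sigma_neutral : exists z : X,
    Sigma empty_family = Some z /\
    forall x, is_summable Sigma x ->
      is_summable Sigma (subfamily [set i : idx x | elt x i <> z]);
  Sigma_bracketing : forall (J : set I) (cJ : countable J)
      (xs : J -> Family I X) (s : J -> X) (x : Family I X) (a : X),
    (forall j, finite_family (xs j)) ->
    (forall j, Sigma (xs j) = Some (s j)) ->
    is_disjoint_union xs x ->
    Sigma x = Some a -> Sigma (MkFamily cJ s) = Some a;
  Sigma_flattening : forall (J : set I) (cJ : countable J)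
      (xs : J -> Family I X) (s : J -> X) (x : Family I X) (a : X),
    finite_set J ->
    (forall j, Sigma (xs j) = Some (s j)) ->
    is_disjoint_union xs x ->
    Sigma (MkFamily cJ s) = Some a -> Sigma x = Some a
}.

Definition finitely_total_Sigma_monoid Sigma : Prop :=
  weak_Sigma_monoid Sigma /\
  forall x, finite_family x -> is_summable Sigma x.

End SigmaMonoids.

Section ExtendedOperation.
Context {I : choiceType} {M : TopologicalNmodule.type}.

Definition finite_sums (x : Family I M) (F : {fset idx x}) : M :=
  \sum_(i <- F) elt x i.

(* [totally] is the filter of tails of the finite subsets of the index set
   directed by inclusion. *)
Definition net_limit (x : Family I M) (a : M) : Prop :=
  @finite_sums x @ summability.totally --> a.

Definition extended_operation (x : Family I M) : option M :=
  if pselect (exists a, net_limit x a) is left cvg_x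
  then Some (sval (cid cvg_x)) else None.

End ExtendedOperation.

(* Main.v *)
Require Import Defs.
From HB Require Import structures.
From mathcomp Require Import all_boot all_order all_algebra finmap.
From mathcomp Require Import all_classical all_reals all_analysis.
From mathcomp.analysis Require showcase.summability.

(** In each axiom the limit of one net of finite sums is compared with that of
    another. For neutrality and bracketing, the second net is cofinally
    contained in the first: a finite set of indices [j] has the same sum as the
    union of the corresponding finite blocks, and these unions are eventually
    above any finite subset. For flattening, the sum over a finite set [F] is
    the sum over the finitely many blocks [j] of the sums over the trace of [F]
    on block [j], and the latter converge by continuity of addition.
    Hausdorffness makes the limits unique. *)

Set Implicit Arguments.
Unset Strict Implicit.
Unset Printing Implicit Defensive.

Import GRing.Theory summability.
Local Open Scope classical_set_scope.
Local Open Scope ring_scope.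
#[local] Existing Instance totally_filter.

Section FinitePreimage.
Context {K T : choiceType} (e : K -> T) (e_inj : injective e).

(** [fset_set] sends an infinite set to the empty one; injectivity of [e] keeps this preimage
    finite. *)
Definition fpreimage (F : {fset T}) : {fset K} := fset_set (e @^-1` [set` F]).

Lemma in_fpreimage F k : (k \in fpreimage F) = (e k \in F).
Proof.
rewrite in_fset_set; last by apply: finite_preimage => // ? ? _ _ /e_inj.
by apply/idP/idP; rewrite inE.
Qed.

(** Any finite set above the image of [A] has a preimage above [A]. Convergence over [K] can thus be
    pulled back to a net over [T]. *)
Lemma fpreimage_cvg : fpreimage @ totally --> totally.
Proof.
move=> P [A _ AP]; exists (e @` A)%fset => // F /= AF.
apply: AP => /=; apply/fsubsetP => k kA; rewrite in_fpreimage.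
by apply: (fsubsetP AF); apply: in_imfset.
Qed.

Lemma sum_fpreimage (M : nmodType) (P : pred T) (f : T -> M) (F : {fset T}) :
  (forall i, P i <-> exists k, e k = i) ->
  \sum_(i <- F | P i) f i = \sum_(k <- fpreimage F) f (e k).
Proof.
move=> Pe; rewrite big_fset_condE /=.
transitivity (\sum_(i <- (e @` fpreimage F)%fset) f i);
  last by rewrite big_imfset //= => ? ? _ _; exact: e_inj.
apply: eq_fbigl => i; apply/idP/idP.
  rewrite !inE /= => /andP[iF /Pe[k ki]]; apply/imfsetP; exists k => //=.
  by rewrite in_fpreimage ki.
move=> /imfsetP[k /=]; rewrite in_fpreimage => kF ->.
by rewrite !inE kF; apply/Pe; exists k.
Qed.

End FinitePreimage.

Section UnorderedSum.
Context {M : TopologicalNmodule.type}.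

(** Index types are arbitrary here, so that reindexing does not involve families; for [elt x] this
    is [net_limit x]. *)
Definition unordered_sum (T : choiceType) (f : T -> M) (a : M) : Prop :=
  (fun F : {fset T} => \sum_(i <- F) f i) @ totally --> a.

(** The hypothesis puts the values of some tail of the net of [g] among those of any given tail of
    the net of [f]. *)
Lemma unordered_sum_cofinal (T U : choiceType) (f : T -> M) (g : U -> M) a :
  (forall F0 : {fset T}, exists G0 : {fset U}, forall G, (G0 `<=` G)%fset ->
    exists2 F, (F0 `<=` F)%fset & \sum_(i <- F) f i = \sum_(j <- G) g j) ->
  unordered_sum f a -> unordered_sum g a.
Proof.
move=> FG fa A /fa[F0 _ F0A]; have [G0 G0P] := FG F0.
exists G0 => // G /= /G0P[F F0F]; rewrite /= => <-; exact: F0A.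
Qed.

Lemma unordered_sum_finite (T : choiceType) (f : T -> M) :
  finite_set [set: T] ->
  unordered_sum f (\sum_(i <- fset_set [set: T]) f i).
Proof.
move=> finT; apply: cvg_near_cst; exists (fset_set [set: T]) => // F /= TF.
apply: eq_fbigl => i; have iT : i \in fset_set [set: T].
  by rewrite in_fset_set // inE.
by rewrite iT (fsubsetP TF).
Qed.

Section Blocks.
(** A partition of [T] into blocks: [p] gives the block of an index, and [e j] parametrizes block
    [j] by [K j]. *)
Context {J T : choiceType} {K : J -> choiceType} (p : T -> J).
Context (e : forall j, K j -> T) (f : T -> M) (s : J -> M) (a : M).
Arguments e : clear implicits.
Hypothesis e_inj : forall j, injective (e j).
Hypothesis fibre : forall j i, p i == j <-> exists k, e j k = i.

Lemma sum_blocks (F : {fset T}) (G : {fset J}) :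
  {in F, forall i, p i \in G} ->
  \sum_(i <- F) f i =
  \sum_(j <- G) \sum_(k <- fpreimage (e j) F) f (e j k).
Proof.
move=> FG; transitivity (\sum_(i <- F) \sum_(j <- G | p i == j) f i).
  apply: eq_big_seq => i /FG piG; rewrite big_fset_condE.
  rewrite (_ : [fset _ in _ | _]%fset = [fset p i]%fset) ?big_seq_fset1 //.
  apply/fsetP => j; rewrite !inE eq_sym andbC.
  by case: eqP => // ->; rewrite piG.
rewrite (exchange_big_dep xpredT) //=; apply: eq_bigr => j _.
exact: sum_fpreimage.
Qed.

Lemma unordered_sum_bracketing :
  (forall j, finite_set [set: K j]) ->
  (forall j, s j = \sum_(k <- fset_set [set: K j]) f (e j k)) ->
  unordered_sum f a -> unordered_sum s a.
Proof.
move=> finK sE; apply: unordered_sum_cofinal => F0.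
(* Once [G] contains every block label met by [F0], the union [F] of the whole blocks labelled by
   [G] contains [F0]; it is finite because each block is. *)
exists (p @` F0)%fset => G F0G.
pose F := (\bigcup_(j <- G) e j @` fset_set [set: K j])%fset.
have FP i : (i \in F) = (p i \in G).
  apply/bigfcupP/idP => [[j /andP[jG _] /imfsetP[k _ ->]]|piG].
    suff /eqP -> : p (e j k) == j by [].
    by apply/fibre; exists k.
  exists (p i); rewrite ?piG //; have /fibre[k ki] := eqxx (p i).
  by apply/imfsetP; exists k; rewrite //= in_fset_set // inE.
exists F.
  apply/fsubsetP => i iF0; rewrite FP; apply: (fsubsetP F0G).
  exact: in_imfset.
rewrite (sum_blocks (G := G)); last by move=> i; rewrite FP.
apply: eq_big_seq => j jG; rewrite sE; apply: eq_fbigl => k.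
rewrite in_fpreimage // FP in_fset_set // in_setT.
by have /eqP -> : p (e j k) == j by apply/fibre; exists k.
Qed.

Lemma unordered_sum_flattening :
  finite_set [set: J] ->
  (forall j, unordered_sum (fun k => f (e j k)) (s j)) ->
  unordered_sum f (\sum_(j <- fset_set [set: J]) s j).
Proof.
move=> finJ fs; rewrite /unordered_sum.
(* As [J] is finite, the same full set of labels serves every [F]: the net is a fixed finite sum of
   nets. *)
rewrite (_ : (fun F => _) = (fun F => \sum_(j <- fset_set [set: J])
    \sum_(k <- fpreimage (e j) F) f (e j k))); last first.
  by apply/funext => F; apply: sum_blocks => i _; rewrite in_fset_set // inE.
apply: cvg_big => [|j _]; first exact: add_continuous.
exact: cvg_comp (fpreimage_cvg (@e_inj j)) (fs j).
Qed.

End Blocks.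

Lemma unordered_sum_support (T U : choiceType) (e : U -> T) (f : T -> M) a :
  injective e -> (forall i, f i != 0 <-> exists u, e u = i) ->
  unordered_sum f a -> unordered_sum (f \o e) a.
Proof.
move=> e_inj supp; apply: unordered_sum_cofinal => F0.
(* The nonzero indices of [F0] already lie in the image of [G], so adjoining [F0] only adds zero
   terms. *)
exists (fpreimage e F0) => G F0G; exists (F0 `|` e @` G)%fset.
  exact: fsubsetUl.
rewrite (bigID (fun i => f i != 0)) /= [X in _ + X]big1 ?addr0; last first.
  by move=> i; rewrite negbK => /eqP.
rewrite (sum_fpreimage e_inj) //; apply: eq_fbigl => u.
rewrite in_fpreimage // inE (mem_imfset _ _ e_inj) /= -in_fpreimage //.
by apply/orP/idP => [[/(fsubsetP F0G)|]|]; last right.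
Qed.

Lemma unordered_sum_bij (T U : choiceType) (e : U -> T) (f : T -> M) a :
  bijective e -> unordered_sum f a -> unordered_sum (f \o e) a.
Proof.
move=> e_bij; have [g eK gK] := e_bij.
have e_inj := bij_inj e_bij.
apply: unordered_sum_cofinal => F0; exists (fpreimage e F0) => G F0G.
exists (e @` G)%fset; last by rewrite big_imfset //= => ? ? _ _; exact: e_inj.
apply/fsubsetP => i iF0; rewrite -(gK i); apply: in_imfset.
by apply: (fsubsetP F0G); rewrite in_fpreimage // gK.
Qed.

End UnorderedSum.

Section ExtendedOperation.
Context {I : choiceType} {M : TopologicalNmodule.type}.
Hypothesis hausM : hausdorff_space M.
Implicit Types (x y : Family I M) (a : M).

Lemma unordered_sum_unique (T : choiceType) (f : T -> M) a b :
  unordered_sum f a -> unordered_sum f b -> a = b.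
Proof. exact: cvg_unique. Qed.

(** The operation picks some limit by choice; uniqueness of limits makes it the only one. *)
Lemma extended_operationP x a :
  extended_operation x = Some a <-> unordered_sum (elt x) a.
Proof.
rewrite /extended_operation; case: pselect => [cvg_x|ncvg_x].
  case: (cid cvg_x) => b xb /=; split => [[<-] //|xa].
  by congr Some; exact: unordered_sum_unique xb xa.
by split => // xa; case: ncvg_x; exists a.
Qed.

Lemma extended_operation_eq x y :
  (forall a, unordered_sum (elt x) a <-> unordered_sum (elt y) a) ->
  extended_operation x = extended_operation y.
Proof.
move=> xy; case Ey: (extended_operation y) => [a|].
  by apply/extended_operationP/xy/extended_operationP.
case Ex: (extended_operation x) => [a|//].
by move/extended_operationP/xy/extended_operationP: Ex; rewrite Ey.
Qed.

Lemma finite_set_type (T : Type) (A : set T) :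
  finite_set A -> finite_set [set: A].
Proof. by rewrite (eq_finite_set (card_setT A)). Qed.

Lemma extended_operation_finite x : finite_family x ->
  extended_operation x = Some (\sum_(i <- fset_set [set: idx x]) elt x i).
Proof.
move=> finx; apply/extended_operationP.
by apply: unordered_sum_finite; exact: finite_set_type.
Qed.

(** Turns the bijection with the dependent sum of index sets into the block data used for bracketing
    and flattening: [p] is its first component, and [e j] the inverse restricted to summand [j]. *)
Lemma disjoint_union_blocks (J : set I) (xs : J -> Family I M) x :
  is_disjoint_union xs x ->
  exists (p : idx x -> J) (e : forall j, idx (xs j) -> idx x),
    [/\ forall j, injective (e j),
        forall j i, p i == j <-> exists k, e j k = i &
        forall j k, elt x (e j k) = elt (xs j) k].
Proof.
move=> [phi [[psi phiK psiK] eltE]].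
exists (tag \o phi), (fun j k => psi (Tagged (fun j => idx (xs j)) k)).
split=> [j k l /(can_inj psiK)|j i|j k].
- exact: existT_inj2.
- split=> [/eqP <-|[k <-]]; last by rewrite /= psiK.
  by exists (tagged (phi i)); rewrite /= taggedK phiK.
- by rewrite eltE psiK.
Qed.

End ExtendedOperation.

Theorem theorem2 (I : choiceType) (infI : infinite_set [set: I]%classic)
    (M : TopologicalNmodule.type) (hausM : hausdorff_space M) :
  finitely_total_Sigma_monoid (@extended_operation I M).
Proof.
have opP := extended_operationP hausM.
have op_finite := @extended_operation_finite I M hausM.
split; last by move=> x /op_finite xE; eexists; exact: xE.
split.
- move=> x y [phi [phi_bij xy]]; apply: extended_operation_eq => // a.
  have [psi phiK psiK] := phi_bij.
  have -> : elt x = elt y \o phi by apply/funext.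
  split=> [ya|]; last exact: unordered_sum_bij.
  (* Invariance under bijections is one-way, so this direction reindexes along the inverse [psi]. *)
  rewrite (_ : elt y = (elt y \o phi) \o psi); last first.
    by apply/funext => i /=; rewrite psiK.
  by apply: unordered_sum_bij ya; exists phi.
- move=> i a; rewrite op_finite; last exact: finite_set1.
  pose i0 : [set i] := exist _ i (mem_set erefl).
  rewrite (_ : fset_set _ = [fset i0]%fset) ?big_seq_fset1 //.
  apply/fsetP => k; rewrite in_fset_set; last exact/finite_set_type/finite_set1.
  by rewrite in_setT inE; apply/esym/eqP/(@val_inj _ _ [set i])/(set_valP k).
- exists 0; split.
    rewrite op_finite; last exact: finite_set0.
    by rewrite big1 // => k; case: (set_mem (valP k)).
  move=> x [a /opP xa]; exists a; apply/opP.
  pose nz := [set i : idx x | elt x i <> 0].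
  (* The subfamily is indexed by the image of [nz] in [I]; [e] is the inclusion back into [idx x],
     with range the support of [elt x]. *)
  pose e (u : idx (subfamily nz)) : idx x :=
    exist _ (val u) (mem_set (subfamily_idx (set_mem (valP u)))).
  apply: (unordered_sum_support (e := e)) xa => [u v /(congr1 val) uv|i].
    exact: (@val_inj _ _ (idx (subfamily nz))).
  split=> [/eqP nzi|[u <-]].
    have iP : val i \in val @` nz by apply: mem_set; exists i.
    by exists (exist _ (val i) iP); exact: val_inj.
  apply/eqP; have [k nzk ku] := set_mem (valP u).
  by rewrite (_ : e u = k) //; exact/val_inj/esym.
- move=> J cJ xs s x a fin_xs xsE /disjoint_union_blocks[p [e [e_inj fibre eltE]]].
  move=> /opP xa; apply/opP.
  apply: (unordered_sum_bracketing e_inj fibre) xa => j.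
    exact: finite_set_type (fin_xs j).
  (* On a finite block the operation is the plain sum, which identifies [s j] with the block sum. *)
  have := xsE j; rewrite op_finite //= => -[<-].
  by apply: eq_bigr => k _; rewrite eltE.
- move=> J cJ xs s x a finJ xsE /disjoint_union_blocks[p [e [e_inj fibre eltE]]].
  rewrite op_finite // => -[<-]; apply/opP.
  apply: (unordered_sum_flattening e_inj fibre) => [|j].
    exact: finite_set_type.
  have -> : (fun k => elt x (e j k)) = elt (xs j) by apply/funext => k.
  exact/opP.
Qed.
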